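(* Let $n\in\mathbb N$ and put $k=\lfloor\frac n2\rfloor$. Then $$e(\mathcal{PB}_n)=n!\cdot\sum_{\mu\vdash n}\frac{\prod_{j=1}^k\left(1+\frac1{2j}\right)^{\mu_{2j}}}{\prod_{i=1}^n\mu_i!}\;2^{\mu_1+\mu_3+\cdots}.$$ If $0\le r\le n$, then $$e(D_r(\mathcal{PB}_n))=n!\cdot\sum_{\substack{\mu\vdash n\\ \mu_1+\mu_3+\cdots\ge r}}\frac{\prod_{j=1}^k\left(1+\frac1{2j}\right)^{\mu_{2j}}}{\prod_{i=1}^n\mu_i!}\binom{\mu_1+\mu_3+\cdots}{r}.$$
   Context: $\mathbb N=\{0,1,2,\dots\}$. Write $\mathbf n=\{1,\dots,n\}$ and let $\mathbf n'$ be a disjoint copy. The partial Brauer monoid $\mathcal{PB}_n$ is the set of all set partitions $\alpha$ of $\mathbf n\cup\mathbf n'$ into non-empty blocks of size at most $2$ ($\mathcal{PB}_0=\{\emptyset\}$). Product: for $\alpha,\beta\in\mathcal{PB}_n$ take a third copy $\mathbf n''$; relabel each lower vertex $x'$ of $\alpha$ as $x''$ and each upper vertex $x$ of $\beta$ as $x''$, and take the union graph $\Gamma(\alpha,\beta)$ on $\mathbf n\cup\mathbf n'\cup\mathbf n''$ (blocks of size $2$ being viewed as edges); $x,y\in\mathbf n\cup\mathbf n'$ are in the same block of $\alpha\beta$ iff they are joined by a path in $\Gamma(\alpha,\beta)$. The rank of $\alpha$ is the number of blocks meeting both $\mathbf n$ and $\mathbf n'$, and $D_r(\mathcal{PB}_n)=\{\alpha\in\mathcal{PB}_n:\operatorname{rank}(\alpha)=r\}$.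 For $\Sigma\subseteq\mathcal{PB}_n$, $e(\Sigma)$ is the number of $\alpha\in\Sigma$ with $\alpha^2=\alpha$. $\mu\vdash n$ means $\mu$ is an integer partition of $n$, and $\mu_i$ denotes the number of parts of $\mu$ equal to $i$; $\mu_1+\mu_3+\cdots$ is the number of odd parts. *)

(* Defs.v *)
From mathcomp Require Import all_boot all_order all_algebra.

Set Implicit Arguments.
Unset Strict Implicit.
Unset Printing Implicit Defensive.

(* Elements of 'I_n are 0-based: [inl i] is the upper vertex i+1 and [inr i]  *)
(* the lower vertex (i+1)'.                                                   *)
Definition vertex (n : nat) : finType := ('I_n + 'I_n)%type.

Definition PB (n : nat) : {set {set {set vertex n}}} :=
  [set a : {set {set vertex n}} |
     partition a [set: vertex n] && [forall B in a, #|B| <= 2]].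

(* Vertices of the product graph: [inl v] is the vertex v of n u n', and      *)
(* [inr i] is the middle vertex (i+1)''.                                      *)
Definition pvertex (n : nat) : finType := (vertex n + 'I_n)%type.

Definition lower_to_mid (n : nat) (v : vertex n) : pvertex n :=
  match v with inl i => inl (inl i) | inr i => inr i end.

Definition upper_to_mid (n : nat) (v : vertex n) : pvertex n :=
  match v with inl i => inr i | inr i => inl (inr i) end.

Definition pgraph (n : nat) (a b : {set {set vertex n}}) : rel (pvertex n) :=
  fun x y =>
    (x != y) &&
    [|| [exists B in a, [set x; y] == [set lower_to_mid v | v in B]]
      | [exists B in b, [set x; y] == [set upper_to_mid v | v in B]]].

(* Meant for a, b in PB n, but total on arbitrary sets of blocks.             *)
Definition mulPB (n : nat) (a b : {set {set vertex n}}) :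
    {set {set vertex n}} :=
  equivalence_partition
    (fun x y : vertex n => connect (pgraph a b) (inl x) (inl y))
    [set: vertex n].

Definition rank (n : nat) (a : {set {set vertex n}}) : nat :=
  #|[set B in a | [exists i : 'I_n, inl i \in B]
                  && [exists j : 'I_n, inr j \in B]]|.

Definition DPB (n r : nat) : {set {set {set vertex n}}} :=
  [set a in PB n | rank a == r].

Definition num_idem (n : nat) (S : {set {set {set vertex n}}}) : nat :=
  #|[set a in S | mulPB a a == a]|.

Definition is_intpart (n : nat) (s : seq nat) : bool :=
  [&& sorted geq s, all (leq 1) s & sumn s == n].

(* A partition of n has at most n parts, each at most n, so all partitions    *)
(* live in the finite type n.-bseq 'I_n.+1; see intpartsP.                    *)
Definition parts (n : nat) (mu : n.-bseq 'I_n.+1) : seq nat :=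
  map (@nat_of_ord n.+1) mu.

Definition intparts (n : nat) : {set n.-bseq 'I_n.+1} :=
  [set mu : n.-bseq 'I_n.+1 | is_intpart n (parts mu)].

Definition mult (n : nat) (mu : n.-bseq 'I_n.+1) (i : nat) : nat :=
  count_mem i (parts mu).

(* mu_1 + mu_3 + ...; every part of a partition of n is at most n.            *)
Definition odd_parts (n : nat) (mu : n.-bseq 'I_n.+1) : nat :=
  \sum_(1 <= i < n.+1 | odd i) mult mu i.

Lemma parts_inj (n : nat) : injective (@parts n).
Proof. by move=> mu nu /(inj_map val_inj) /val_inj. Qed.

Lemma intpartsP (n : nat) (s : seq nat) :
  reflect (exists2 mu, mu \in intparts n & parts mu = s) (is_intpart n s).
Proof.
apply: (iffP idP) => [ps | [mu]]; last by rewrite inE => ? <-.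
have [_ /allP s_gt0 /eqP sum_s] := and3P ps.
have size_s : size s <= n.
  rewrite -sum_s; elim: s {ps sum_s} s_gt0 => //= x s IHs s_gt0.
  rewrite -add1n leq_add ?s_gt0 ?mem_head // IHs // => y ys.
  by rewrite s_gt0 // inE ys orbT.
have le_s x : x \in s -> x < n.+1.
  rewrite ltnS -sum_s; elim: (s) => //= y t IHt; rewrite inE => /predU1P[->|xt].
    exact: leq_addr.
  exact: leq_trans (IHt xt) (leq_addl _ _).
have size_t : size (map (@inord n) s) <= n by rewrite size_map.
have val_t : parts (Bseq size_t) = s.
  rewrite /parts /= -map_comp -[RHS]map_id.
  by apply/eq_in_map => x xs /=; rewrite inordK ?le_s.
by exists (Bseq size_t) => //; rewrite inE val_t.
Qed.

(* Main.v *)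
Require Import Defs.
From mathcomp Require Import all_boot all_order all_algebra.
From mathcomp Require Import ring.
Set Implicit Arguments.
Unset Strict Implicit.
Unset Printing Implicit Defensive.
Import GRing.Theory Num.Theory.
Local Open Scope ring_scope.

(** An element of the monoid is the same as an involution f of the 2n vertices
    whose orbits {v, f v} are the blocks.  Forgetting the transversals of f
    leaves its upper and lower hooks, that is, a pair of involutions (u, l) of
    {1..n}; draw an edge of colour u (resp. l) for every 2-cycle of u (resp. l).
    Every component of this coloured graph is a path or a cycle along which the
    colours alternate.

    Squaring f glues the lower hooks of one copy to the upper hooks of the
    other, so the middle row of the product graph is exactly the graph of
    (u, l).  Hence f is idempotent iff, for each transversal {x, y'}, the points
    x and y lie in one component ([mulPB_idem_matching]).  Here x is a fixed
    point of u and y one of l, so the component must be a path whose ends lack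
    different colours: a path with an odd number of points.  Such a path
    has just one fixed point of either kind ([end_unique]).  So an idempotent
    with hooks (u, l) amounts to a set of odd paths of (u, l), those closed by
    a transversal, and its rank is the size of that set ([card_idem_matching]).
    With d odd paths there are 2^d idempotents, and 'C(d, r) of rank r.

    It remains to sum phi (number of odd paths) over all pairs (u, l), for an
    arbitrary function phi.  On m given points there are m! alternating paths
    if m is odd, and m! paths together with (m-1)! cycles if m is even; divided
    by m!, these are the factors 1 and 1 + 1/m, and the exponential formula
    gives the sum over integer partitions.  Concretely, both sides satisfy
    the recursion F(phi, 0) = phi 0 and
      n F(phi, n) = \sum_(1 <= m <= n) m c_m F(phi_m, n - m),
    where F is the count divided by n!, c_m is the above factor and
    phi_m d = phi ([m odd] + d).  For partitions it comes from removing one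
    part ([part_sum_rec]).  For pairs it comes from walking
    along the component of a fixed vertex, first in one direction and then in
    the other, until the path ends or closes up ([sum_open]); the other
    vertices carry an arbitrary pair of involutions ([weight_sum_glue]). *)

(** * Weighted sums over integer partitions *)

Definition part_seqs (n : nat) : seq (seq nat) :=
  [seq parts mu | mu in intparts n].

Lemma mem_part_seqs n s : (s \in part_seqs n) = is_intpart n s.
Proof.
apply/mapP/intpartsP => -[mu]; last by exists mu; rewrite ?mem_enum.
by rewrite mem_enum => mu_in ->; exists mu.
Qed.

Lemma part_seqs_uniq n : uniq (part_seqs n).
Proof. by rewrite map_inj_uniq ?enum_uniq //; apply: parts_inj. Qed.

Lemma geq_trans : transitive geq.
Proof. by move=> x y z /= xy /leq_trans; apply. Qed.

Lemma geq_total : total geq. Proof. by move=> x y /=; apply: leq_total. Qed.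

Lemma geq_anti : antisymmetric geq.
Proof. by move=> x y; rewrite /= andbC => /anti_leq. Qed.

Definition add_part i s := sort geq (i :: s).

Lemma add_part_perm i s : perm_eq (add_part i s) (i :: s).
Proof. by rewrite perm_sort. Qed.

(** Removing one part equal to i is inverse to inserting one; this makes the
    partitions of n that have a part i correspond to the partitions of n - i. *)
Lemma part_seqs_rem n i : (0 < i <= n)%N ->
  perm_eq [seq s <- part_seqs n | i \in s]
    [seq add_part i s | s <- part_seqs (n - i)].
Proof.
case/andP=> i_gt0 i_le_n; apply: uniq_perm.
- by rewrite filter_uniq // part_seqs_uniq.
- rewrite map_inj_in_uniq ?part_seqs_uniq // => s t; rewrite !mem_part_seqs.
  case/and3P=> s_sort _ _ /and3P[t_sort _ _] eq_st.
  apply: (sorted_eq geq_trans geq_anti) => //.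
  rewrite -(perm_cons i) -(permPl (add_part_perm i s)) eq_st.
  exact: add_part_perm.
move=> s; rewrite mem_filter mem_part_seqs; apply/andP/mapP.
  case=> i_s /and3P[s_sort s_pos /eqP s_sum].
  have s_perm : perm_eq s (i :: rem i s) by apply: perm_to_rem.
  exists (rem i s).
    rewrite mem_part_seqs; apply/and3P; split.
    - exact: (subseq_sorted geq_trans (rem_subseq i s)).
    - by apply/allP=> x /mem_rem; apply: (allP s_pos).
    - by rewrite -s_sum (perm_sumn s_perm) /= addKn.
  apply: (sorted_eq geq_trans geq_anti) => //.
    exact: (sort_sorted geq_total).
  by rewrite (permPl s_perm) perm_sym add_part_perm.
case=> r; rewrite mem_part_seqs => /and3P[r_sort r_pos /eqP r_sum] ->.
have p := add_part_perm i r.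
split; first by rewrite (perm_mem p) mem_head.
apply/and3P; split.
- exact: (sort_sorted geq_total).
- by rewrite (perm_all _ p) /= i_gt0.
- by rewrite (perm_sumn p) /= r_sum subnKC.
Qed.

Definition even_coef (i : nat) : rat := if odd i then 1 else 1 + 1 / i%:R.

(** All factors with i larger than every part are 1.  Keeping the bound N apart
    from the partitioned number lets it stay constant through the recursion. *)
Definition part_weight (N : nat) (s : seq nat) : rat :=
  \prod_(1 <= i < N.+1) (even_coef i ^+ count_mem i s / (count_mem i s)`!%:R).

Definition part_sum (N : nat) (phi : nat -> rat) (n : nat) : rat :=
  \sum_(s <- part_seqs n) part_weight N s * phi (count odd s).

(** Splitting off a component with m points (or a part m) changes the number of
    odd ones by [odd m]; [shift] moves this change into the weight function. *)
Definition shift (phi : nat -> rat) (m : nat) : nat -> rat :=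
  fun d => phi (odd m + d)%N.

(** The multiplicity on the left turns the factor 1 / mu_i! of the larger
    partition into the factor 1 / (mu_i - 1)! of the smaller one. *)
Lemma part_weight_add N i s : (0 < i <= N)%N ->
  (count_mem i (add_part i s))%:R * part_weight N (add_part i s) =
  even_coef i * part_weight N s.
Proof.
move=> iN; rewrite /part_weight.
have i_in : i \in index_iota 1 N.+1 by rewrite mem_index_iota ltnS.
rewrite !(bigD1_seq i) ?iota_uniq //=.
rewrite (permP (add_part_perm i s)) /= eqxx add1n exprS factS natrM.
under eq_bigr => j jNi.
  rewrite (permP (add_part_perm i s)) /= eq_sym (negPf jNi) add0n; over.
set P := \prod_(_ <- _ | _) _.
by field; rewrite -(natrD _ 1) !pnatr_eq0 -lt0n fact_gt0.
Qed.

Lemma sumn_count_mem n s : all (leq 1) s -> sumn s = n ->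
  (n = \sum_(1 <= i < n.+1) i * count_mem i s)%N.
Proof.
move=> s_pos sum_s.
have le_n x : x \in s -> (x <= n)%N.
  rewrite -sum_s => /perm_to_rem /perm_sumn -> /=; exact: leq_addr.
rewrite -[LHS]sum_s sumnE.
under [RHS]eq_bigr => i _ do rewrite -sumn_count sumnE big_map big_distrr /=.
rewrite exchange_big /= !big_seq; apply: eq_bigr => x x_s.
rewrite (bigD1_seq x) ?iota_uniq ?mem_index_iota ?ltnS ?le_n ?(allP s_pos) //=.
rewrite eqxx muln1 big1 ?addn0 // => j; rewrite eq_sym => /negPf->.
exact: muln0.
Qed.

(** Write n as the sum of i * mu_i, exchange the two sums, and remove a part i
    from every partition that has one. *)
Lemma part_sum_rec N phi n : (n <= N)%N ->
  n%:R * part_sum N phi n =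
  \sum_(1 <= i < n.+1)
     i%:R * even_coef i * part_sum N (shift phi i) (n - i).
Proof.
move=> nN; rewrite /part_sum big_distrr /=.
rewrite (eq_big_seq (fun s => \sum_(1 <= i < n.+1) i%:R * (count_mem i s)%:R *
   (part_weight N s * phi (count odd s)))); last first.
  move=> s; rewrite mem_part_seqs => /and3P[_ s_pos /eqP sum_s].
  rewrite {1}(sumn_count_mem s_pos sum_s) natr_sum big_distrl /=.
  by apply: eq_bigr => i _; rewrite natrM.
rewrite exchange_big /=; apply: eq_big_nat => i; rewrite ltnS => i_n.
have iN : (0 < i <= N)%N.
  by case/andP: i_n => -> /leq_trans; apply.
rewrite (bigID (mem^~ i)) /= [X in _ + X]big1 ?addr0; last first.
  by move=> s /count_memPn ->; rewrite mulr0 mul0r.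
rewrite -big_filter (perm_big _ (part_seqs_rem i_n)) big_map big_distrr /=.
apply: eq_bigr => s _; rewrite -mulrA [(count_mem _ _)%:R * _]mulrA.
rewrite part_weight_add //.
by rewrite (permP (add_part_perm i s)) /shift /= !mulrA.
Qed.

Lemma part_sum0 N phi : part_sum N phi 0 = phi 0%N.
Proof.
have p0 : perm_eq (part_seqs 0) [:: [::]].
  apply: uniq_perm; rewrite ?part_seqs_uniq // => s.
  rewrite mem_part_seqs inE; apply/idP/eqP => [|->]; last by [].
  by case: s => // -[|x] s; rewrite /is_intpart /= ?andbF.
by rewrite /part_sum (perm_big _ p0) big_seq1 /part_weight big1 ?mul1r.
Qed.

Lemma odd_partsE n (mu : n.-bseq 'I_n.+1) : mu \in intparts n ->
  odd_parts mu = count odd (parts mu).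
Proof.
rewrite inE => /and3P[_ s_pos _]; rewrite /odd_parts /mult.
under eq_bigr => i _ do rewrite -sumn_count sumnE big_map.
rewrite exchange_big -sumn_count sumnE big_map /= !big_seq.
apply: eq_bigr => x x_s; rewrite big_mkcond /=.
have xn : (x < n.+1)%N by case/mapP: x_s => j _ ->.
rewrite (bigD1_seq x) ?iota_uniq ?mem_index_iota ?xn ?(allP s_pos) //= eqxx.
rewrite big1 => [|i]; first by case: odd.
by rewrite eq_sym => /negPf->; case: odd.
Qed.

Lemma prod_even (F : nat -> rat) n :
  \prod_(1 <= j < (n./2).+1) F (2 * j)%N =
  \prod_(1 <= i < n.+1) (if odd i then 1 else F i).
Proof.
elim: n => [|n IHn]; first by rewrite !big_geq.
rewrite [RHS]big_nat_recr //= -{}IHn uphalf_half.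
case: (boolP (odd n)) => on /=; last by rewrite add0n mulr1.
rewrite add1n big_nat_recr //=; congr (_ * F _).
by rewrite mul2n doubleS -[in RHS](odd_double_half n) on add1n.
Qed.

Lemma part_weightE n (mu : n.-bseq 'I_n.+1) :
  (\prod_(1 <= j < (n./2).+1) (1 + 1 / (2 * j)%:R) ^+ mult mu (2 * j))
       / (\prod_(1 <= i < n.+1) (mult mu i)`!%:R) = part_weight n (parts mu).
Proof.
rewrite (prod_even (fun i => (1 + 1 / i%:R) ^+ mult mu i)) -prodfV -big_split /=.
by apply: eq_bigr => i _; rewrite /even_coef /mult; case: ifP; rewrite ?expr1n.
Qed.

Lemma part_sumE n phi :
  part_sum n phi n =
  \sum_(mu in intparts n)
     (\prod_(1 <= j < (n./2).+1) (1 + 1 / (2 * j)%:R) ^+ mult mu (2 * j))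
       / (\prod_(1 <= i < n.+1) (mult mu i)`!%:R) * phi (odd_parts mu).
Proof.
rewrite /part_sum /part_seqs /image_mem big_map big_enum /=.
by apply: eq_bigr => mu mu_in; rewrite part_weightE odd_partsE.
Qed.

(** * Pairs of involutions and their odd paths *)

Section InvolutionPairs.
Variable T : finType.
Implicit Types (A R S : {set T}) (t : {ffun bool * T -> T}) (b c : bool).
Implicit Types (x y z w v : T) (s : seq T).

(** A pair of involutions supported on A, stored as one finite function so that
    the two colours (false for u, true for l) can be exchanged by [~~]. *)
Definition invol_pair A t : bool :=
  [forall b, forall x,
     (t (b, t (b, x)) == x) && ((x \notin A) ==> (t (b, x) == x))].

Lemma invol_pairP A t :
  reflect ((forall b x, t (b, t (b, x)) = x) /\
           (forall b x, x \notin A -> t (b, x) = x)) (invol_pair A t).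
Proof.
apply: (iffP forallP) => [H | [tK tA] b]; last first.
  by apply/forallP=> x; rewrite tK eqxx; apply/implyP=> /(tA b)->.
split=> b x; have /forallP/(_ x)/andP[/eqP tK tA] := H b; first exact: tK.
by move=> xA; apply/eqP/(implyP tA).
Qed.

Lemma invol_pairK A t b x : invol_pair A t -> t (b, t (b, x)) = x.
Proof. by case/invol_pairP. Qed.

Lemma invol_pair_out A t b x : invol_pair A t -> x \notin A -> t (b, x) = x.
Proof. by case/invol_pairP=> _; apply. Qed.

Lemma invol_pair_in A t b x : invol_pair A t -> (t (b, x) \in A) = (x \in A).
Proof.
move=> tP; apply/idP/idP; apply: contraLR => xA.
  by rewrite (invol_pair_out b tP).
by rewrite -(invol_pairK b x tP) (invol_pair_out b tP).
Qed.

Definition adj t : rel T := [rel x y | (t (false, x) == y) || (t (true, x) == y)].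

Lemma adjP t x y : reflect (exists b, t (b, x) = y) (adj t x y).
Proof.
apply: (iffP orP) => [[/eqP<-|/eqP<-] | [[] <-]];
  by [exists false | exists true | right | left].
Qed.

Lemma adj_connect_sym A t : invol_pair A t -> connect_sym (adj t).
Proof.
move=> tP; apply: sym_connect_sym => x y.
by apply/adjP/adjP=> -[b <-]; exists b; apply: (invol_pairK b _ tP).
Qed.

(** Of the two ends of an odd path (one point, if the path has no edge) one is
    fixed by u and the other by l; so this set has one point for each odd path
    inside A. *)
Definition odd_ends A t : {set T} :=
  [set x in A | (t (false, x) == x)
     && [exists y, (t (true, y) == y) && connect (adj t) x y]].

Definition stable S t := forall b x, x \in S -> t (b, x) \in S.

Lemma connect_stable S t x y :
  stable S t -> x \in S -> connect (adj t) x y -> y \in S.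
Proof.
move=> tS xS /connectP[p xp ->]; elim: p x xS xp => //= z p IHp x xS.
by case/andP=> /adjP[b <-] /IHp; apply; apply: tS.
Qed.

(** A stable set is a union of components, so connectedness from a point of it
    depends only on the restriction to the set. *)
Lemma connect_agree S t t' x y : stable S t ->
  (forall b z, z \in S -> t' (b, z) = t (b, z)) -> x \in S ->
  connect (adj t) x y -> connect (adj t') x y.
Proof.
move=> tS tt' xS /connectP[p xp ->]; elim: p x xS xp => //= z p IHp x xS.
case/andP=> /adjP[b tx] zp; apply: connect_trans (IHp z _ zp); last first.
  by rewrite -tx tS.
by apply/connect1/adjP; exists b; rewrite tt'.
Qed.

Lemma odd_ends_agree S t t' : stable S t ->
  (forall b z, z \in S -> t' (b, z) = t (b, z)) -> odd_ends S t' = odd_ends S t.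
Proof.
move=> tS tt'; have t'S : stable S t' by move=> b x xS; rewrite tt' ?tS.
apply/setP=> x; rewrite !inE; case: (boolP (x \in S)) => //= xS.
rewrite tt' //; congr (_ && _).
have t't b z : z \in S -> t (b, z) = t' (b, z) by move/tt'.
apply/existsP/existsP=> -[y /andP[/eqP ty xy]]; exists y.
  have yS := connect_stable t'S xS xy.
  by rewrite -{1}tt' // ty eqxx (connect_agree t'S).
have yS := connect_stable tS xS xy.
by rewrite tt' // ty eqxx (connect_agree tS).
Qed.

Definition weight_sum (phi : nat -> rat) A : rat :=
  \sum_(t | invol_pair A t) phi #|odd_ends A t|.

Definition agree S t0 t := [forall b, forall x in S, t (b, x) == t0 (b, x)].

Lemma agreeP S t0 t :
  reflect (forall b x, x \in S -> t (b, x) = t0 (b, x)) (agree S t0 t).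
Proof.
apply: (iffP forallP) => [H b x xS | H b].
  by have /forall_inP/(_ x xS)/eqP := H b.
by apply/forall_inP=> x xS; rewrite H.
Qed.

Definition splice S t0 t : {ffun bool * T -> T} :=
  [ffun p => if p.2 \in S then t0 p else t p].

Definition idpair : {ffun bool * T -> T} := [ffun p => p.2].

Lemma invol_pair_stable A t : invol_pair A t -> stable A t.
Proof. by move=> tP b x; rewrite (invol_pair_in b x tP). Qed.

(** A pair that agrees with t0 on S, where t0 permutes S, is t0 together with an
    arbitrary pair on the complement; odd paths on the two sides add up. *)
Lemma weight_sum_glue (phi : nat -> rat) A S t0 : S \subset A -> invol_pair S t0 ->
  \sum_(t | invol_pair A t && agree S t0 t) phi #|odd_ends A t| =
  weight_sum (fun d => phi (#|odd_ends S t0| + d)%N) (A :\: S).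
Proof.
move=> SA t0P; rewrite /weight_sum.
(* Splicing in t0 is undone by resetting the pair to the identity on S. *)
rewrite (reindex_onto (splice S t0) (splice S idpair)) /=; last first.
  move=> t /andP[tP /agreeP tt0]; apply/ffunP=> -[b x]; rewrite !ffunE /=.
  by case: ifP => xS; [rewrite tt0 | rewrite xS].
have t0S := invol_pair_stable t0P.
apply: eq_big => [t | t /andP[/andP[tP tt0] /eqP sp_t]].
  apply/andP/idP=> [[/andP[tP _] /eqP sp_t] | tP].
    have tid b x : x \in S -> t (b, x) = x.
      by move=> xS; rewrite -sp_t ffunE /= xS ffunE.
    apply/invol_pairP; split=> b x; last first.
      rewrite inE negb_and negbK; case: (boolP (x \in S)) => [/tid | xS /= xA] //.
      by have := invol_pair_out b tP xA; rewrite ffunE /= (negPf xS).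
    case: (boolP (x \in S)) => xS.
      by rewrite !tid.
    have:= invol_pairK b x tP; rewrite [splice S t0 t (b, x)]ffunE /= (negPf xS).
    rewrite ffunE /=; case: ifP => // txS t0x.
    by case/negP: xS; rewrite -t0x t0S.
  have tS : stable (~: S) t.
    move=> b x; rewrite !inE => xS; case: (boolP (t (b, x) \in S)) => // txS.
    case/negP: (xS); rewrite -(invol_pairK b x tP) (invol_pair_out b tP) //.
    by rewrite inE txS.
  split; last first.
    apply/eqP/ffunP=> -[b x]; rewrite !ffunE /=; case: ifP => xS.
      by rewrite (invol_pair_out b tP) // inE xS.
    by rewrite xS.
  apply/andP; split; last by apply/agreeP=> b x xS; rewrite ffunE /= xS.
  apply/invol_pairP; split=> b x; rewrite !ffunE /=; case: (boolP (x \in S)) => xS.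
  - by rewrite t0S // (invol_pairK b x t0P).
  - have := tS b x; rewrite !inE xS => /(_ isT)/negPf->.
    exact: (invol_pairK b x tP).
  - by rewrite (subsetP SA).
  by move=> xA; rewrite (invol_pair_out b tP) // inE negb_and xA orbT.
have sS : stable S (splice S t0 t) by move=> b x xS; rewrite ffunE /= xS t0S.
have sR : stable (A :\: S) (splice S t0 t).
  move=> b x; rewrite !inE => /andP[xS xA].
  rewrite (invol_pair_in b x tP) xA andbT.
  apply: contra xS => /(sS b); by rewrite (invol_pairK b x tP).
have -> : odd_ends A (splice S t0 t) =
    odd_ends S (splice S t0 t) :|: odd_ends (A :\: S) (splice S t0 t).
  apply/setP=> x; rewrite !in_set.
  case: (boolP (x \in S)) => xS; rewrite /= ?orbF //.
  by rewrite (subsetP SA).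
rewrite cardsU; set I := _ :&: _; have -> : I = set0.
  apply/setP=> x; rewrite !in_set; case: (x \in S) => //=; exact: andbF.
rewrite cards0 subn0; congr (phi (_ + _)%N).
  rewrite (odd_ends_agree (t := t0)) // => b z zS; by rewrite ffunE /= zS.
rewrite -(odd_ends_agree (t' := t) sR) // => b z.
by rewrite inE ffunE /= => /andP[/negPf->].
Qed.

Lemma weight_sum0 phi : weight_sum phi set0 = phi 0%N.
Proof.
rewrite /weight_sum (big_pred1 idpair) => [|t] /=.
  congr phi; apply: eq_card0 => x; by rewrite !inE.
apply/invol_pairP/eqP => [[_ tid] | ->]; last by split=> b x; rewrite !ffunE.
by apply/ffunP=> -[b x]; rewrite tid ?inE // ffunE.
Qed.
End InvolutionPairs.

(** * Alternating trails *)

Lemma neq_negb (c b : bool) : c != b -> c = ~~ b.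
Proof. by case: c b => -[]. Qed.

Section Trails.
Variable T : finType.
Implicit Types (A R S : {set T}) (t : {ffun bool * T -> T}) (b c : bool).
Implicit Types (x y z w v : T) (s : seq T).

(** The colour b is that of the first edge, and it is kept even when there is no
    edge: then it still fixes which colour is missing at which end. *)
Fixpoint trail t b x s : bool :=
  if s is y :: s' then (t (b, x) == y) && trail t (~~ b) y s' else true.

(** The colour of the edge that would prolong the trail beyond its last vertex;
    before its first vertex x it is [~~ b]. *)
Definition end_color b s : bool := b (+) odd (size s).

(** The two half-edges (colour, vertex) on which a trail puts no condition:
    every other half-edge at a vertex of the trail lies inside it. *)
Definition trail_end b x s c z : bool :=
  ((c, z) == (~~ b, x)) || ((c, z) == (end_color b s, last x s)).

Lemma end_color_cons b x s : end_color b (x :: s) = end_color (~~ b) s.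
Proof. by rewrite /end_color /= addbN addNb. Qed.

Lemma trail_rcons t b x s y :
  trail t b x (rcons s y) = trail t b x s && (t (end_color b s, last x s) == y).
Proof.
elim: s b x => [|z s IHs] b x /=; first by rewrite /end_color addbF andbT.
by rewrite IHs end_color_cons andbA.
Qed.

Lemma trail_connect t b x s : trail t b x s -> connect (adj t) x (last x s).
Proof.
elim: s b x => [|y s IHs] b x //= /andP[/eqP txy /IHs]; apply: connect_trans.
by apply/connect1/adjP; exists b.
Qed.

Lemma trail_agree A A' t t' b x s c z : invol_pair A t -> invol_pair A' t' ->
  trail t b x s -> trail t' b x s -> z \in x :: s ->
  trail_end b x s c z || (t (c, z) == t' (c, z)).
Proof.
move=> tP t'P; elim: s b x => [|y s IHs] b x /=.
  rewrite inE /trail_end /end_color /= => _ _ /eqP->.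
  by case: b c => -[]; rewrite /= !eqxx ?orbT.
case/andP=> /eqP tx ty /andP[/eqP t'x t'y].
rewrite inE => /predU1P[-> | z_s].
  case: (eqVneq c b) => [->|cb]; first by rewrite tx t'x eqxx orbT.
  by rewrite /trail_end (neq_negb cb) eqxx.
have /= := IHs _ _ ty t'y z_s; rewrite /trail_end end_color_cons /= negbK.
case/orP=> [/orP[/eqP[-> ->]|->] | ->]; rewrite ?orbT //.
have ty_x : t (b, y) = x by rewrite -tx (invol_pairK b x tP).
have t'y_x : t' (b, y) = x by rewrite -t'x (invol_pairK b x t'P).
by rewrite ty_x t'y_x eqxx orbT.
Qed.

Lemma trail_in A t b x s c z : invol_pair A t -> trail t b x s -> z \in x :: s ->
  trail_end b x s c z || (t (c, z) \in x :: s).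
Proof.
move=> tP; elim: s b x => [|y s IHs] b x /=.
  rewrite inE /trail_end /end_color /= => _ /eqP->.
  by case: b c => -[]; rewrite /= !eqxx ?orbT.
case/andP=> /eqP tx ty; rewrite inE => /predU1P[-> | z_s].
  case: (eqVneq c b) => [->|cb]; first by rewrite tx !inE eqxx !orbT.
  by rewrite /trail_end (neq_negb cb) eqxx.
have /= := IHs _ _ ty z_s; rewrite /trail_end end_color_cons /= negbK.
case/orP=> [/orP[/eqP[-> ->]|->] | ]; rewrite ?orbT //.
  by rewrite -[X in t (_, X)]tx (invol_pairK b x tP) mem_head orbT.
by move=> h; rewrite [_ \in x :: _]inE h !orbT.
Qed.

Lemma trail_fix A t b x s c z : invol_pair A t -> trail t b x s ->
  uniq (x :: s) -> z \in x :: s -> t (c, z) = z -> trail_end b x s c z.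
Proof.
move=> tP; elim: s b x => [|y s IHs] b x /=.
  rewrite inE /trail_end /end_color /= => _ _ /eqP->.
  by case: b c => -[]; rewrite /= !eqxx ?orbT.
case/andP=> /eqP tx ty /andP[xs ys]; rewrite inE => /predU1P[-> tc | z_s tc].
  case: (eqVneq c b) => [cb|cb].
    by rewrite cb tx in tc; rewrite tc mem_head in xs.
  by rewrite /trail_end (neq_negb cb) eqxx.
have /= := IHs _ _ ty ys z_s tc; rewrite /trail_end end_color_cons /= negbK.
case/orP=> [/eqP[cb zy]|->]; rewrite ?orbT //.
rewrite cb zy in tc; have := invol_pairK b x tP.
by rewrite tx tc => yx; rewrite yx mem_head in xs.
Qed.

(** Prolonging a trail at its last vertex either stops there, or leaves the
    trail, or returns to the first vertex: inner vertices have both their edges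
    already.  A return uses the colour missing at x, whence the parity. *)
Lemma trail_last_in A t b x s : invol_pair A t -> trail t b x s ->
  uniq (x :: s) -> t (end_color b s, last x s) \in x :: s ->
  t (end_color b s, last x s) = last x s \/
  t (end_color b s, last x s) = x /\ odd (size s).
Proof.
move=> tP; elim: s b x => [|y s IHs] b x /=; first by rewrite inE => _ _ /eqP; left.
case/andP=> /eqP tx ty /andP[xs /= ys]; rewrite end_color_cons.
set w := t _; rewrite inE => /predU1P[wx | w_s].
  right; split=> //; apply/negP=> os.
  have := invol_pairK (end_color (~~ b) s) (last y s) tP.
  rewrite -/w wx /end_color os addbT negbK tx => yl.
  case: (s) os yl ys => // u r _ /= -> /andP[]; by rewrite mem_last.
have := IHs _ _ ty ys w_s; rewrite -/w => -[wl|[wy os]]; first by left.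
have := invol_pairK (end_color (~~ b) s) (last y s) tP.
rewrite -/w wy /end_color os addbT negbK => yl.
by have := invol_pairK b x tP; rewrite tx yl => xl; rewrite -xl mem_last in xs.
Qed.

(** If t (~~ b, x) were a later vertex w of the trail, the edge from w to x would
    leave the rest of the trail; but with the far end closed, all edges of that
    rest stay inside it, except the one of colour b from its first vertex. *)
Lemma trail_head_in A t b x s : invol_pair A t -> trail t b x s ->
  uniq (x :: s) -> t (end_color b s, last x s) = last x s ->
  t (~~ b, x) \in x :: s -> t (~~ b, x) = x.
Proof.
move=> tP tr us tl; rewrite inE => /predU1P[// |].
set w := t _ => w_s; have tw : t (~~ b, w) = x by rewrite (invol_pairK _ _ tP).
case: s tr us w_s tl => //= y s /andP[/eqP tx ty] /andP[xs ys] w_s tl.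
have := trail_in (~~ b) tP ty w_s; rewrite tw (negPf xs) orbF /trail_end.
case/orP=> /eqP[]; first by case: (b).
move=> cb wl; rewrite end_color_cons -cb -wl tw in tl.
by rewrite tl w_s in xs.
Qed.

Definition add_edge t c x y : {ffun bool * T -> T} :=
  [ffun p => if p == (c, x) then y else if p == (c, y) then x else t p].

Lemma add_edge_inv A t c x y : invol_pair A t -> x \in A -> y \in A ->
  t (c, x) = x -> t (c, y) = y -> invol_pair A (add_edge t c x y).
Proof.
move=> tP xA yA tx ty; apply/invol_pairP; split=> b z; last first.
  move=> zA; rewrite ffunE !xpair_eqE.
  case: (eqVneq z x) => [zx|_]; first by rewrite zx xA in zA.
  case: (eqVneq z y) => [zy|_]; first by rewrite zy yA in zA.
  by rewrite !andbF (invol_pair_out b tP).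
rewrite [add_edge _ _ _ _ (b, z)]ffunE !xpair_eqE.
case: (eqVneq b c) => [->|bc] /=; last first.
  by rewrite ffunE !xpair_eqE (negPf bc) /= (invol_pairK b z tP).
case: (eqVneq z x) => [->|zx] /=.
  by rewrite ffunE !xpair_eqE eqxx /= eqxx; case: eqP.
case: (eqVneq z y) => [->|zy] /=; first by rewrite ffunE eqxx.
rewrite ffunE !xpair_eqE eqxx /=.
case: eqVneq => [tzx|_].
  by case/eqP: zx; rewrite -(invol_pairK c z tP) tzx.
case: eqVneq => [tzy|_]; last by rewrite (invol_pairK c z tP).
by case/eqP: zy; rewrite -(invol_pairK c z tP) tzy.
Qed.

Lemma trail_ext t t' b x s :
  {in x :: s, forall z c, t (c, z) != z -> t' (c, z) = t (c, z)} ->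
  uniq (x :: s) -> trail t b x s -> trail t' b x s.
Proof.
elim: s b x => //= y s IHs b x tt' /andP[xs ys] /andP[/eqP tx ty].
rewrite tt' ?mem_head ?tx ?eqxx //=; last first.
  by apply: contraNneq xs => ->; rewrite mem_head.
by apply: IHs => // z zs; apply: tt'; rewrite inE zs orbT.
Qed.

Lemma add_edge_ext t c x y d z : t (c, x) = x -> t (c, y) = y ->
  t (d, z) != z -> add_edge t c x y (d, z) = t (d, z).
Proof.
move=> tx ty tz; rewrite ffunE.
case: eqP => [[dc zx] | _]; first by rewrite dc zx tx eqxx in tz.
by case: eqP => [[dc zy] | //]; rewrite dc zy ty eqxx in tz.
Qed.

Lemma invol_pairS A A' t : A \subset A' -> invol_pair A t -> invol_pair A' t.
Proof.
move=> AA' /invol_pairP[tK tA]; apply/invol_pairP; split=> // b x xA'.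
by apply: tA; apply: contra xA'; apply: (subsetP AA').
Qed.

(** Every injective sequence is an isolated alternating path of some pair; it is
    built by adding the edges one at a time, from the far end. *)
Lemma path_exists b x s : uniq (x :: s) ->
  exists t, [/\ invol_pair [set z in x :: s] t, trail t b x s, t (~~ b, x) = x
              & t (end_color b s, last x s) = last x s].
Proof.
elim: s b x => [|y s IHs] b x.
  move=> _; exists (idpair T); split=> //; try by rewrite ffunE.
  by apply/invol_pairP; split=> *; rewrite !ffunE.
case/andP=> xs ys; have [t [tP ty tl tr]] := IHs (~~ b) y ys.
rewrite negbK in tl.
have tx c : t (c, x) = x by rewrite (invol_pair_out c tP) // inE.
exists (add_edge t b x y); split.
- apply: add_edge_inv; rewrite ?inE ?eqxx ?orbT //; apply: invol_pairS tP.
  by apply/subsetP=> z; rewrite !inE => ->; rewrite orbT.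
- rewrite /= ffunE eqxx eqxx /=.
  by apply: trail_ext ty => // z _ c; apply: add_edge_ext.
- by rewrite ffunE !xpair_eqE; case: (b) tx => /=; apply.
rewrite end_color_cons /= ffunE !xpair_eqE.
case: (eqVneq _ x) => [lx|_]; first by rewrite -lx mem_last in xs.
rewrite andbF; case: (eqVneq _ b) => [e|_] //=; case: (eqVneq _ y) => [ly|_] //.
case: s ys e ly {xs IHs tP ty tr} => /= [_|u r /andP[ys _] _ ly].
  by rewrite /end_color addbF; case: (b).
by rewrite -ly mem_last in ys.
Qed.

Lemma cycle_exists b x s : uniq (x :: s) -> odd (size s) ->
  exists t, [/\ invol_pair [set z in x :: s] t, trail t b x s
              & t (end_color b s, last x s) = x].
Proof.
move=> us os; have [t [tP tr th tl]] := path_exists b us.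
have ec : end_color b s = ~~ b by rewrite /end_color os addbT.
rewrite ec in tl *.
exists (add_edge t (~~ b) (last x s) x); split.
- by apply: add_edge_inv; rewrite // !inE ?eqxx // -in_cons mem_last.
- by apply: trail_ext tr => // z _ c; apply: add_edge_ext.
by rewrite ffunE eqxx.
Qed.

(** The ends are the only fixed points on the path, x for colour [~~ b] and
    last x s for [end_color b s]; these colours differ iff size s is even, that
    is, iff the number of vertices is odd. *)
Lemma odd_ends_path t b x s : invol_pair [set z in x :: s] t -> trail t b x s ->
  uniq (x :: s) -> t (~~ b, x) = x -> t (end_color b s, last x s) = last x s ->
  #|odd_ends [set z in x :: s] t| = ~~ odd (size s).
Proof.
move=> tP tr us th tl; set S := [set z in x :: s].
have tS := invol_pair_stable tP.
have fixE c z : z \in S -> t (c, z) = z -> trail_end b x s c z.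
  by rewrite inE => zS; apply: trail_fix tP tr us zS.
have [os|es] /= := boolP (odd (size s)).
  apply: eq_card0 => z; rewrite in_set; apply/negP.
  case/and3P=> zS /eqP tz /existsP[y /andP[/eqP ty zy]].
  have yS := connect_stable tS zS zy.
  move: (fixE _ _ zS tz) (fixE _ _ yS ty).
  by rewrite /trail_end /end_color os !xpair_eqE addbT; case: (b).
have hl := trail_connect tr; have lh := hl.
rewrite (adj_connect_sym tP) in lh.
have ec : end_color b s = b by rewrite /end_color (negPf es) addbF.
rewrite ec in tl.
rewrite -(cards1 (if b then x else last x s)); congr #|pred_of_set _|.
apply/setP=> z; rewrite in_set1 in_set; apply/and3P/eqP.
  case=> zS /eqP/(fixE _ _ zS); rewrite /trail_end !xpair_eqE ec.
  by case: (b) => /=; rewrite ?orbF => /eqP.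
move=> ->; case: (b) tl th => /= tl th; split.
- by rewrite inE mem_head.
- by rewrite th.
- by apply/existsP; exists (last x s); rewrite tl eqxx.
- by rewrite inE mem_last.
- by rewrite tl.
by apply/existsP; exists x; rewrite th eqxx.
Qed.

Lemma odd_ends_cycle t b x s : invol_pair [set z in x :: s] t -> trail t b x s ->
  uniq (x :: s) -> odd (size s) -> t (end_color b s, last x s) = x ->
  #|odd_ends [set z in x :: s] t| = 0%N.
Proof.
move=> tP tr us os tl; apply: eq_card0 => z; rewrite in_set; apply/negP.
rewrite inE => /and3P[zS /eqP tz _].
have ec : end_color b s = ~~ b by rewrite /end_color os addbT.
have xl : last x s != x.
  by case: s os us {tr tl tz zS ec tP} => //= y s _ /andP[xs _];
     apply: contraNneq xs => <-; rewrite mem_last.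
have := trail_fix tP tr us zS tz; rewrite /trail_end ec => /orP[]/eqP[e ez].
  move: tz; rewrite e ez -{1}tl ec (invol_pairK _ _ tP); exact/eqP.
by move: tz; rewrite e ez -ec tl => /eqP; rewrite eq_sym (negPf xl).
Qed.

End Trails.

(** * Counting by exploring a component *)

Section Exploration.
Variable T : finType.
Implicit Types (A R S : {set T}) (t : {ffun bool * T -> T}) (b c : bool).
Implicit Types (x y z w v : T) (s : seq T) (phi : nat -> rat).

Definition half_closed t b x s : bool :=
  trail t b x s && (t (end_color b s, last x s) == last x s).

Definition closed_path t b x s : bool :=
  half_closed t b x s && (t (~~ b, x) == x).

Definition closed_cycle t b x s : bool :=
  trail t b x s && (t (end_color b s, last x s) == x).

Lemma shift_even phi m : ~~ odd m -> shift phi m =1 phi.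
Proof. by move=> /negPf om d; rewrite /shift om. Qed.

Lemma eq_weight_sum phi psi A : phi =1 psi -> weight_sum phi A = weight_sum psi A.
Proof. by move=> e; apply: eq_bigr => t _; rewrite e. Qed.

Lemma eq_part_sum phi psi N n : phi =1 psi -> part_sum N phi n = part_sum N psi n.
Proof. by move=> e; apply: eq_bigr => s _; rewrite e. Qed.

(** A closed path is a whole component, and the sequence x :: s determines the
    pair on it. *)
Lemma sum_closed_path phi A b x s : uniq (x :: s) -> {subset x :: s <= A} ->
  \sum_(t | invol_pair A t && closed_path t b x s) phi #|odd_ends A t| =
  weight_sum (shift phi (size s).+1) (A :\: [set z in x :: s]).
Proof.
move=> us sA; have [t0 [t0P t0tr t0h t0l]] := path_exists b us.
have SA : [set z in x :: s] \subset A by apply/subsetP=> z; rewrite inE => /sA.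
have odd0 := odd_ends_path t0P t0tr us t0h t0l.
rewrite (eq_bigl (fun t => invol_pair A t && agree [set z in x :: s] t0 t)).
  by rewrite (weight_sum_glue _ SA t0P) odd0.
move=> t; apply: andb_id2l => tP; apply/idP/agreeP => [|tt0].
  case/andP=> /andP[tr /eqP tl] /eqP th c z; rewrite inE => zS.
  case/orP: (trail_agree c tP t0P tr t0tr zS) => [/orP[]|] /eqP
    => [[-> ->]|[-> ->]|] //.
    by rewrite th t0h.
  by rewrite tl t0l.
rewrite /closed_path /half_closed !tt0 ?inE ?eqxx -?in_cons ?mem_last //.
rewrite t0h t0l !eqxx !andbT.
by apply: trail_ext t0tr => // z zS c _; rewrite tt0 // inE.
Qed.

Lemma sum_closed_cycle phi A b x s : uniq (x :: s) -> odd (size s) ->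
  {subset x :: s <= A} ->
  \sum_(t | invol_pair A t && closed_cycle t b x s) phi #|odd_ends A t| =
  weight_sum phi (A :\: [set z in x :: s]).
Proof.
move=> us os sA; have [t0 [t0P t0tr t0l]] := cycle_exists b us os.
have SA : [set z in x :: s] \subset A by apply/subsetP=> z; rewrite inE => /sA.
have odd0 := odd_ends_cycle t0P t0tr us os t0l.
have ec : end_color b s = ~~ b by rewrite /end_color os addbT.
have headE A' t : invol_pair A' t -> t (end_color b s, last x s) = x ->
    t (~~ b, x) = last x s.
  by move=> tP tl; rewrite -[in LHS]tl ec (invol_pairK _ _ tP).
rewrite (eq_bigl (fun t => invol_pair A t && agree [set z in x :: s] t0 t)).
  by rewrite (weight_sum_glue _ SA t0P) odd0; apply: eq_weight_sum.
move=> t; apply: andb_id2l => tP; apply/idP/agreeP => [|tt0].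
  case/andP=> tr /eqP tl c z; rewrite inE => zS.
  case/orP: (trail_agree c tP t0P tr t0tr zS) => [/orP[]|] /eqP
    => [[-> ->]|[-> ->]|] //.
    by rewrite (headE _ _ tP tl) (headE _ _ t0P t0l).
  by rewrite tl t0l.
rewrite /closed_cycle !tt0 ?inE -?in_cons ?mem_last // t0l eqxx andbT.
by apply: trail_ext t0tr => // z zS c _; rewrite tt0 // inE.
Qed.

Lemma cardsD_extend A w r : w \in A :\: [set z in r] ->
  (#|A :\: [set z in r]| = #|A :\: [set z in w :: r]|.+1)%N.
Proof.
move=> wA; rewrite (cardsD1 w) wA add1n; congr _.+1.
by apply: eq_card => z; rewrite !inE negb_or andbA.
Qed.

(** Sort the pairs by the vertex that continues the trail before x: either x
    itself, and the path is closed, or a fresh vertex w. *)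
Lemma sum_half_closed_step (F : {ffun bool * T -> T} -> rat) A b x s :
  uniq (x :: s) -> {subset x :: s <= A} ->
  \sum_(t | invol_pair A t && half_closed t b x s) F t =
  \sum_(t | invol_pair A t && closed_path t b x s) F t +
  \sum_(w in A :\: [set z in x :: s])
     \sum_(t | invol_pair A t && half_closed t (~~ b) w (x :: s)) F t.
Proof.
move=> us sA; set S := [set z in x :: s].
rewrite (partition_big (fun t => t (~~ b, x)) (mem A)) /=; last first.
  by move=> t /andP[tP _]; rewrite (invol_pair_in _ _ tP) sA ?mem_head.
rewrite (bigID (mem S)) /= (bigD1 x) /=; last first.
  by rewrite sA ?inE eqxx.
rewrite [X in _ + X + _]big1 ?addr0 => [|w /andP[/andP[wA wS] wx]]; last first.
  apply: big1 => t; case/andP=> /andP[tP /andP[tr /eqP tl]] /eqP tw.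
  case/eqP: wx; rewrite -tw; apply: (trail_head_in tP tr us tl).
  by rewrite tw; rewrite inE in wS.
congr (_ + _); first by apply: eq_bigl => t; rewrite -andbA.
apply: eq_big => [w|w /andP[_ wS]]; first by rewrite !inE andbC.
apply: eq_bigl => t; rewrite -andbA; apply: andb_id2l => tP.
rewrite /half_closed end_color_cons /= !negbK -[RHS]andbA.
have -> : (t (~~ b, w) == x) = (t (~~ b, x) == w).
  by apply/eqP/eqP=> <-; rewrite (invol_pairK _ _ tP).
by rewrite andbC.
Qed.

(** Sort the pairs by the vertex that continues the trail beyond its end: the
    end itself, the first vertex x (closing a cycle), or a fresh vertex w. *)
Lemma sum_trail_step (F : {ffun bool * T -> T} -> rat) A b x s :
  uniq (x :: s) -> {subset x :: s <= A} ->
  \sum_(t | invol_pair A t && trail t b x s) F t =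
  \sum_(t | invol_pair A t && half_closed t b x s) F t +
  (if odd (size s) then \sum_(t | invol_pair A t && closed_cycle t b x s) F t
   else 0) +
  \sum_(w in A :\: [set z in x :: s])
     \sum_(t | invol_pair A t && trail t b x (rcons s w)) F t.
Proof.
move=> us sA; set S := [set z in x :: s]; set l := last x s.
have lS : l \in S by rewrite inE mem_last.
have xS : x \in S by rewrite inE mem_head.
have SA z : z \in S -> z \in A by rewrite inE => /sA.
rewrite (partition_big (fun t => t (end_color b s, l)) (mem A)) /=; last first.
  by move=> t /andP[tP _]; rewrite (invol_pair_in _ _ tP) SA.
rewrite (bigID (mem S)) /= (bigD1 l) /= ?SA //; congr (_ + _ + _).
- by apply: eq_bigl => t; rewrite -andbA.
- have in0 w : w \in S -> w != l -> ~~ odd (size s) || (w != x) ->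
      \sum_(t | invol_pair A t && trail t b x s && (t (end_color b s, l) == w))
        F t = 0.
    move=> wS wl wx; apply: big1 => t /andP[/andP[tP tr] /eqP tw].
    rewrite -tw in wS wl wx; rewrite inE in wS.
    case: (trail_last_in tP tr us wS) => [e|[e os]]; last by rewrite e os eqxx in wx.
    by rewrite e eqxx in wl.
  case: ifP => os; last first.
    by apply: big1 => w /andP[/andP[_ wS] wl]; rewrite in0 // os.
  have xl : x != l.
    move: us; rewrite /l; case: (s) os => //= y r _ /andP[xs _].
    by apply: contraNneq xs => ->; rewrite mem_last.
  rewrite (bigD1 x) ?SA ?xS //= [X in _ + X]big1 ?addr0.
    by apply: eq_bigl => t; rewrite -andbA.
  by move=> w /andP[/andP[/andP[_ wS] wl] wx]; rewrite in0 // wx orbT.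
apply: eq_big => [w|w /andP[_ wS]]; first by rewrite !inE andbC.
by apply: eq_bigl => t; rewrite -andbA trail_rcons.
Qed.

Section Induction.
Variables (N n : nat).
Hypothesis IHn : forall A phi, (#|A| < n)%N ->
  weight_sum phi A = #|A|`!%:R * part_sum N phi #|A|.

Lemma rem_lt A x s : {subset x :: s <= A} -> (#|A| <= n)%N ->
  (#|A :\: [set z in x :: s]| < n)%N.
Proof.
move=> sA; apply: leq_trans; apply: proper_card; apply/properP; split.
  exact: subsetDl.
by exists x; rewrite ?sA ?mem_head // !inE eqxx.
Qed.

(** The index j is the number of vertices still to be added to the path: there
    are k! / (k - j)! ways to choose them in order, and the factor (k - j)! comes
    back with the pairs on the other k - j vertices. *)
Lemma sum_half_closed phi A k b x s : (#|A| <= n)%N -> uniq (x :: s) ->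
  {subset x :: s <= A} -> #|A :\: [set z in x :: s]| = k ->
  \sum_(t | invol_pair A t && half_closed t b x s) phi #|odd_ends A t| =
  k`!%:R * \sum_(0 <= j < k.+1) part_sum N (shift phi ((size s).+1 + j)) (k - j).
Proof.
move=> An; elim: k b x s => [|k IHk] b x s us sA cardR.
all: rewrite sum_half_closed_step // sum_closed_path // IHn ?rem_lt // cardR.
  by rewrite big_nat1 addn0 big_pred0 ?addr0 //; apply: card0_eq.
rewrite big_nat_recl // mulrDr addn0 subn0; congr (_ + _).
rewrite (eq_bigr (fun=> k`!%:R * \sum_(0 <= j < k.+1)
   part_sum N (shift phi ((size s).+1 + j.+1)) (k - j))) => [|w wR].
  by rewrite sumr_const cardR -[_ *+ k.+1]mulr_natl mulrA -natrM.
have [wA ws] : w \in A /\ w \notin x :: s.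
  by move: wR; rewrite !inE => /andP[].
rewrite IHk /=.
- by under eq_bigr => j _ do rewrite addSnnS.
- by rewrite ws.
- by move=> z; rewrite inE => /predU1P[->|/sA].
by apply: succn_inj; rewrite -cardR -cardsD_extend.
Qed.

(** When a trail of m vertices is completed by j further ones, j + 1
    distributions of these over the two ends give a path, and the trail can also
    become a cycle if m + j is even.  A cycle has no odd path, so phi is not
    shifted there. *)
Definition open_term phi m k j : rat :=
  j.+1%:R * part_sum N (shift phi (m + j)) (k - j)
  + (~~ odd (m + j))%:R * part_sum N phi (k - j).

Lemma sum_open phi A k b x s : (#|A| <= n)%N -> uniq (x :: s) ->
  {subset x :: s <= A} -> #|A :\: [set z in x :: s]| = k ->
  \sum_(t | invol_pair A t && trail t b x s) phi #|odd_ends A t| =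
  k`!%:R * \sum_(0 <= j < k.+1) open_term phi (size s).+1 k j.
Proof.
move=> An; elim: k b x s => [|k IHk] b x s us sA cardR.
all: rewrite sum_trail_step // (@sum_half_closed phi A _ b x s An us sA cardR).
all: rewrite (_ : (if _ then _ else _) = (odd (size s))%:R *
  (#|A :\: [set z in x :: s]|`!%:R * part_sum N phi #|A :\: [set z in x :: s]|));
  last by case: ifP => os; rewrite ?mul0r // mul1r sum_closed_cycle // IHn // rem_lt.
all: rewrite cardR.
  rewrite [X in _ + X]big_pred0; last exact: card0_eq.
  by rewrite !big_nat1 /open_term addn0 /= negbK addr0 !mul1r.
rewrite [X in _ + X](eq_bigr (fun=> k`!%:R * \sum_(0 <= j < k.+1)
   open_term phi (size s).+2 k j)) => [|w wR]; last first.
  have [wA ws] : w \in A /\ w \notin x :: s.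
    by move: wR; rewrite !inE => /andP[].
  have eS : [set z in w :: x :: s] = [set z in x :: rcons s w].
    by apply/setP=> z; rewrite !inE mem_rcons inE orbCA.
  rewrite IHk ?size_rcons //.
  - by rewrite -rcons_cons rcons_uniq ws.
  - by move=> z; rewrite -rcons_cons mem_rcons inE => /predU1P[->|/sA].
  by apply: succn_inj; rewrite -cardR -eS -cardsD_extend.
rewrite sumr_const cardR -[_ *+ k.+1]mulr_natl [k.+1%:R * _]mulrA -[k.+1%:R * _]natrM.
rewrite -factS [(odd _)%:R * _]mulrCA -!mulrDr; congr (_ * _).
rewrite [in RHS]big_nat_recl // [in LHS]big_nat_recl // /open_term !addn0 !subn0 /= negbK.
rewrite mul1r -!addrA; congr (_ + _); rewrite addrCA; congr (_ + _).
rewrite -big_split /=; apply: eq_bigr => j _.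
rewrite !subSS !addnS !addSn /= !negbK -[j.+2%:R]natr1; ring.
Qed.
End Induction.

(** Exploring the component of one vertex v of A gives the recursion of
    [part_sum_rec]: the coefficient of a component with j + 1 vertices is j + 1,
    plus 1 if it has an even number of vertices, in both cases
    (j + 1) * even_coef (j + 1). *)
Lemma weight_sumE N phi A : (#|A| <= N)%N ->
  weight_sum phi A = #|A|`!%:R * part_sum N phi #|A|.
Proof.
move En : #|A| => n nN; elim/ltn_ind: n => n IHn in A phi En nN *.
case: n => [|n] in IHn En nN *.
  by rewrite (cards0_eq En) weight_sum0 part_sum0 mul1r.
have /card_gt0P[v vA] : (0 < #|A|)%N by rewrite En.
have IH (B : {set T}) psi : (#|B| < n.+1)%N ->
    weight_sum psi B = #|B|`!%:R * part_sum N psi #|B|.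
  by move=> Bn; apply: (IHn _ Bn) => //; apply: leq_trans (ltnW Bn) nN.
have cardR : #|A :\: [set z in [:: v]]| = n.
  have -> : [set z in [:: v]] = [set v] by apply/setP=> z; rewrite !inE.
  by apply: succn_inj; rewrite -En (cardsD1 v A) vA.
have vsub : {subset [:: v] <= A} by move=> z; rewrite inE => /eqP->.
have := @sum_open N n.+1 IH phi A n false v [::].
rewrite En leqnn => /(_ isT isT vsub cardR); rewrite /weight_sum /=.
under eq_bigl => t do rewrite andbT.
move=> ->; rewrite factS natrM -mulrA [RHS]mulrCA part_sum_rec //; congr (_ * _).
rewrite big_add1 /=; apply: eq_bigr => j _; rewrite subSS /open_term add1n /even_coef.
case: ifP => oj; first by rewrite mul0r addr0 mulr1.
have -> : part_sum N (shift phi j.+1) (n - j) = part_sum N phi (n - j).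
  by apply: eq_part_sum; apply: shift_even; rewrite oj.
rewrite mul1r.
by rewrite mulrDr mulr1 mulfV ?pnatr_eq0 // mulrDl.
Qed.
End Exploration.

(** * Idempotent matchings and sets of odd paths *)

Section Uniqueness.
Variables (T : finType) (A : {set T}) (t : {ffun bool * T -> T}).
Hypothesis tP : invol_pair A t.

(** With g the product of the two involutions and x fixed by one of them, the
    component of x is its g-orbit, on which t (c, -) maps g^k x to g^(-k) x and
    t (~~ c, -) maps it to g^(-k-1) x.  Then x' = g^k x gives g^(2k) x = x, and
    y = g^j x gives g^(2j+1) x = x; together they force g^k x = x. *)
Lemma end_unique c x x' y : t (c, x) = x -> t (c, x') = x' ->
  t (~~ c, y) = y -> connect (adj t) x y -> connect (adj t) x x' -> x = x'.
Proof.
move=> tx tx' ty xy xx'.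
pose g z := t (c, t (~~ c, z)); pose h z := t (~~ c, t (c, z)).
have hK : cancel h g by move=> z; rewrite /g /h !(invol_pairK _ _ tP).
have gK : cancel g h by move=> z; rewrite /g /h !(invol_pairK _ _ tP).
have iterK k : iter k g (iter k h x) = x.
  by elim: k => // k IHk; rewrite iterSr iterS hK.
have tc k : t (c, iter k g x) = iter k h x.
  by elim: k => //= k IHk; rewrite -IHk /h !(invol_pairK _ _ tP).
have tnc k : t (~~ c, iter k g x) = iter k.+1 h x.
  by rewrite iterS -tc /h (invol_pairK _ _ tP).
have itv z : connect (adj t) x z -> exists k, z = iter k g x.
  move=> xz; have sS : stable [set z | fconnect g x z] t.
    have inS k : fconnect g x (iter k h x).
      by rewrite (fconnect_sym (can_inj gK)) -{2}(iterK k) fconnect_iter.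
    move=> b u; rewrite !inE => /iter_findex <-.
    by case: (eqVneq b c) => [->|/neq_negb ->]; rewrite ?tc ?tnc inS.
  have := connect_stable sS _ xz; rewrite !inE => /(_ (connect0 _ _)).
  by move=> /iter_findex <-; eexists.
have [[k kx'] [j jy]] := (itv _ xx', itv _ xy).
have it2k : iter (k + k) g x = x by rewrite iterD -kx' -tx' kx' tc iterK.
have it2j : iter (j.+1 + j) g x = x by rewrite iterD -jy -ty jy tnc iterK.
have itM m i : iter m g x = x -> iter (i * m) g x = x.
  by move=> e; elim: i => // i IHi; rewrite mulSn iterD IHi.
rewrite kx' -{1}(itM _ k it2j).
have -> : (k * (j.+1 + j) = k + j * (k + k))%N by ring.
by rewrite iterD itM.
Qed.
End Uniqueness.

Section Encoding.
Variable n : nat.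
Implicit Types (f : {ffun vertex n -> vertex n}) (x y : 'I_n) (b : bool).
Implicit Types (t : {ffun bool * 'I_n -> 'I_n}) (D : {set 'I_n}).

Definition vx b x : vertex n := if b then inr x else inl x.

Definition same_side b x (v : vertex n) : 'I_n :=
  match v with inl y => if b then x else y | inr y => if b then y else x end.

(** The hooks of a matching: a vertex matched to the opposite row, or to itself,
    becomes a fixed point. *)
Definition hooks f : {ffun bool * 'I_n -> 'I_n} :=
  [ffun p => same_side p.1 p.2 (f (vx p.1 p.2))].

Definition dom f : {set 'I_n} :=
  [set x | if f (inl x) is inr _ then true else false].

Definition involf f := [forall v, f (f v) == v].

(** This is the form that idempotence takes on involutions, by
    [mulPB_idem_matching]. *)
Definition idem_matching f :=
  involf f && [forall x, forall y,
    (f (inl x) == inr y) ==> connect (adj (hooks f)) x y].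

Lemma involfP f : reflect (involutive f) (involf f).
Proof. by apply: (iffP forallP) => H v; apply/eqP. Qed.

Lemma hooks_invol f : involf f -> invol_pair setT (hooks f).
Proof.
move/involfP=> fK; apply/invol_pairP; split=> b x; last by rewrite inE.
rewrite [hooks f (b, x)]ffunE ffunE /=.
case E: (f (vx b x)) (fK (vx b x)) => [y|y]; case: b E => /= E fy; rewrite ?fy ?E //.
Qed.

Lemma idem_matchingP f : reflect
  (involutive f /\ forall x y, f (inl x) = inr y -> connect (adj (hooks f)) x y)
  (idem_matching f).
Proof.
apply: (iffP andP) => [[/involfP fK /forallP H] | [fK H]]; split=> //.
- move=> x y fx; have /forallP/(_ y) := H x; by rewrite fx eqxx.
- exact/involfP.
by apply/forallP=> x; apply/forallP=> y; apply/implyP=> /eqP/H.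
Qed.

Lemma dom_odd_ends f : idem_matching f -> dom f \subset odd_ends setT (hooks f).
Proof.
case/idem_matchingP=> fK fc; apply/subsetP=> x; rewrite inE.
case fx: (f (inl x)) => [//|y] _; rewrite in_set inE ffunE /= fx eqxx /=.
have fy : f (inr y) = inl x by rewrite -fx fK.
by apply/existsP; exists y; rewrite ffunE /= fy eqxx fc.
Qed.

(** A transversal at x can only go to the other end of the odd path of x, so
    the hooks and the domain determine an idempotent. *)
Lemma idem_matching_inj f f' : idem_matching f -> idem_matching f' ->
  hooks f = hooks f' -> dom f = dom f' -> f = f'.
Proof.
move=> fI f'I eh ed.
have fl x : f (inl x) = f' (inl x).
  have := congr1 (fun h : {ffun _} => h (false, x)) eh; rewrite !ffunE /=.
  have := congr1 (fun D : {set 'I_n} => x \in D) ed; rewrite !inE.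
  case/idem_matchingP: fI => fK fc; case/idem_matchingP: f'I => f'K f'c.
  case fx: (f (inl x)) => [u|y]; case f'x: (f' (inl x)) => [u'|y'] // _.
    by move=> /= ->.
  move=> _; congr inr.
  have /hooks_invol hP : involf f by apply/involfP.
  have cxy := fc _ _ fx; have cxy' := f'c _ _ f'x; rewrite -eh in cxy'.
  have sym := adj_connect_sym hP.
  apply: (end_unique hP (c := true) (y := x)).
  - by rewrite ffunE /= -fx fK.
  - by rewrite eh ffunE /= -f'x f'K.
  - by rewrite ffunE /= fx.
  - by rewrite sym.
  by apply: connect_trans cxy'; rewrite sym.
apply/ffunP=> -[x|y] //.
case/idem_matchingP: fI => fK _; case/idem_matchingP: f'I => f'K _.
case fy: (f (inr y)) => [x|z]; first by rewrite -fy -[in RHS](fK (inr y)) fy fl f'K.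
case f'y: (f' (inr y)) => [x|z'].
  by have := fK (inl x); rewrite fl -f'y f'K fy.
have := congr1 (fun h : {ffun _} => h (true, y)) eh.
by rewrite !ffunE /= fy f'y /= => ->.
Qed.

(** Adds to the hooks t the transversals that join the two ends of those odd
    paths whose u-fixed end is in D. *)
Definition assemble t D : {ffun vertex n -> vertex n} :=
  [ffun v => match v with
   | inl x => if x \in D then
        if [pick y | (t (true, y) == y) && connect (adj t) x y] is Some y
        then inr y else inl x
      else inl (t (false, x))
   | inr y => if t (true, y) == y then
        if [pick x | (x \in D) && connect (adj t) x y] is Some x
        then inl x else inr y
      else inr (t (true, y))
   end].

Lemma assemble_idem_matching t D : invol_pair setT t -> D \subset odd_ends setT t ->
  [/\ idem_matching (assemble t D), hooks (assemble t D) = t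
    & dom (assemble t D) = D].
Proof.
move=> tP /subsetP sD; set f := assemble t D.
have sym := adj_connect_sym tP.
have Dfix x : x \in D -> t (false, x) = x.
  by move/sD; rewrite !inE /= => /andP[/eqP].
have fD x : x \in D ->
    exists y, [/\ f (inl x) = inr y, t (true, y) = y & connect (adj t) x y].
  move=> xD; rewrite ffunE xD; case: pickP => [y /andP[/eqP ty xy]|no].
    by exists y.
  by have := sD x xD; rewrite !inE /= => /andP[_ /existsP[y]]; rewrite no.
have fnD x : x \notin D -> f (inl x) = inl (t (false, x)).
  by move/negPf=> xD; rewrite ffunE xD.
have fr y x : t (true, y) = y -> x \in D -> connect (adj t) x y ->
    f (inr y) = inl x.
  move=> ty xD xy; rewrite ffunE ty eqxx; case: pickP => [x' /andP[x'D x'y]|no].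
    congr inl; apply: (end_unique tP (c := false) (y := y)); rewrite ?Dfix //.
    by apply: connect_trans x'y _; rewrite sym.
  by have := no x; rewrite xD xy.
have frP y : (f (inr y) = inr (t (true, y))) \/
    (exists x, [/\ x \in D, t (true, y) = y & connect (adj t) x y]).
  rewrite ffunE; case: eqP => [ty|]; last by left.
  case: pickP => [x /andP[xD xy]|_]; last by rewrite ty; left.
  by right; exists x.
have fK : involutive f.
  move=> [x|y].
    case: (boolP (x \in D)) => xD.
      by have [y [-> ty xy]] := fD x xD; apply: fr.
    rewrite (fnD x xD) fnD; first by rewrite (invol_pairK _ _ tP).
    by apply: contra xD => /[dup] /Dfix; rewrite (invol_pairK _ _ tP) => <-.
  case: (frP y) => [fy|[x [xD ty xy]]]; last first.
    rewrite (fr y x) //; have [y' [-> ty' xy']] := fD x xD; congr inr.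
    apply: (end_unique tP (c := true) (y := x)); rewrite ?Dfix //.
      by rewrite sym.
    by apply: connect_trans xy; rewrite sym.
  rewrite fy; case: (frP (t (true, y))) => [->|[x [xD]]].
    by rewrite (invol_pairK _ _ tP).
  rewrite (invol_pairK _ _ tP) => ty; rewrite -ty => xy.
  by rewrite (fr y x (esym ty) xD xy) in fy.
have hE : hooks f = t.
  apply/ffunP=> -[[] x]; rewrite [LHS]ffunE /=.
    case: (frP x) => [->|[z [zD tx zx]]] //.
    by rewrite (fr x z) //= tx.
  case: (boolP (x \in D)) => xD; last by rewrite fnD.
  by have [y [-> _ _]] := fD x xD; rewrite /= Dfix.
split=> //.
  apply/idem_matchingP; split=> // x y; rewrite hE.
  case: (boolP (x \in D)) => xD; last by rewrite fnD.
  by have [y' [-> _ xy]] := fD x xD; case=> <-.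
apply/setP=> x; rewrite inE; case: (boolP (x \in D)) => xD.
  by have [y [-> _ _]] := fD x xD.
by rewrite fnD.
Qed.

Lemma card_idem_matching (P : pred nat) :
  #|[set f | idem_matching f & P #|dom f|]| =
  (\sum_(t | invol_pair setT t)
     #|[set D : {set 'I_n} | D \subset odd_ends setT t & P #|D|]|)%N.
Proof.
pose code f := (hooks f, dom f).
rewrite -(card_in_imset (f := code)); last first.
  move=> f f'; rewrite !inE => /andP[fI _] /andP[f'I _] [eh ed].
  exact: idem_matching_inj.
have -> : code @: [set f | idem_matching f & P #|dom f|] =
    [set p : {ffun bool * 'I_n -> 'I_n} * {set 'I_n} |
       invol_pair setT p.1 & (p.2 \subset odd_ends setT p.1) && P #|p.2|].
  apply/setP=> -[t D]; rewrite inE /=; apply/imsetP/and3P.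
    case=> f; rewrite inE => /andP[fI Pf] [-> ->]; split=> //.
      by apply: hooks_invol; case/andP: fI.
    exact: dom_odd_ends.
  case=> tP sD PD; have [fI eh ed] := assemble_idem_matching tP sD.
  by exists (assemble t D); rewrite ?inE ?fI ?ed // /code eh ed.
rewrite -sum1_card; under [RHS]eq_bigr => t _ do rewrite -sum1_card.
by rewrite pair_big_dep; apply: eq_bigl => -[t D]; rewrite !inE.
Qed.
End Encoding.

(** * The product of the monoid in terms of matchings *)

Section Blocks.
Variable n : nat.
Implicit Types (f : {ffun vertex n -> vertex n}) (x y z : 'I_n).
Implicit Types (u v : vertex n) (a : {set {set vertex n}}).

Definition block_rel f : rel (vertex n) := fun u v => (v == u) || (v == f u).

Definition blocks f : {set {set vertex n}} :=
  equivalence_partition (block_rel f) [set: vertex n].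

Lemma equivalence_partition_inj (T : finType) (R R' : rel T) :
  {in [set: T] & &, equivalence_rel R} -> {in [set: T] & &, equivalence_rel R'} ->
  equivalence_partition R [set: T] = equivalence_partition R' [set: T] -> R =2 R'.
Proof.
move=> Req R'eq eq_part x y.
rewrite -(pblock_equivalence_partition Req) ?inE // eq_part.
by rewrite (pblock_equivalence_partition R'eq) ?inE.
Qed.

Lemma block_rel_equiv f : involutive f ->
  {in [set: vertex n] & &, equivalence_rel (block_rel f)}.
Proof.
move=> fK u v w _ _ _; rewrite /block_rel; split; first by rewrite eqxx.
by case/orP=> /eqP-> //; rewrite fK orbC.
Qed.

Lemma mem_blocks f (B : {set vertex n}) :
  reflect (exists u, B = [set u; f u]) (B \in blocks f).
Proof.
have bE u : [set v in [set: vertex n] | block_rel f u v] = [set u; f u].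
  by apply/setP=> v; rewrite !inE /block_rel.
apply: (iffP imsetP) => [[u _ ->]|[u ->]]; exists u; rewrite ?inE //.
Qed.

Lemma blocks_PB f : involutive f -> blocks f \in PB n.
Proof.
move=> fK; rewrite inE; apply/andP; split.
  by apply: equivalence_partitionP; apply: block_rel_equiv.
by apply/forall_inP=> B /mem_blocks[u ->]; rewrite cards2; case: eqP.
Qed.

Lemma blocks_inj f f' : involutive f -> involutive f' -> blocks f = blocks f' -> f = f'.
Proof.
move=> fK f'K /(equivalence_partition_inj (block_rel_equiv fK) (block_rel_equiv f'K)).
move=> e; apply/ffunP=> u.
have := e u (f u); rewrite /block_rel eqxx orbT => /esym/orP[/eqP fu|/eqP //].
by have := e u (f' u); rewrite /block_rel fu eqxx orbT orbb => /eqP.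
Qed.

Lemma PB_blocks a : a \in PB n ->
  exists2 f : {ffun vertex n -> vertex n}, involutive f & a = blocks f.
Proof.
rewrite inE => /andP[aP /forall_inP a2]; have [/eqP aT aI _] := and3P aP.
pose f : {ffun vertex n -> vertex n} :=
  [ffun u => odflt u [pick v in pblock a u :\ u]].
have inB u : u \in pblock a u by rewrite mem_pblock aT inE.
have Ba u : pblock a u \in a by rewrite pblock_mem ?aT ?inE.
have fB u : pblock a u = [set u; f u].
  have := a2 _ (Ba u); rewrite (cardsD1 u) inB add1n ltnS ffunE.
  case: pickP => [v vB|no] /=.
    move/card_le1_eqP => B1; rewrite -(setD1K (inB u)); congr (_ |: _).
    by apply/setP=> w; rewrite [RHS]inE; apply/idP/eqP => [wB|->//]; apply: B1.
  rewrite setUid => _; apply/setP=> w; have := no w; rewrite !inE.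
  by case: eqVneq => [-> _|_ /=]; rewrite ?inB.
have fK : involutive f.
  move=> u; have fuB : f u \in pblock a u by rewrite fB !inE eqxx orbT.
  have := fB (f u); rewrite (same_pblock aI fuB) fB => e.
  have : f (f u) \in [set u; f u] by rewrite e !inE eqxx orbT.
  rewrite !inE => /orP[/eqP //|/eqP ffu].
  have : u \in [set f u; f (f u)] by rewrite -e !inE eqxx.
  by rewrite !inE ffu orbb => /eqP <-.
exists f => //; rewrite -[LHS](equivalence_partition_pblock aP).
apply: eq_imset => u; apply/setP=> v; by rewrite !inE fB !inE.
Qed.

(** Each transversal block contains exactly one upper vertex. *)
Lemma rank_blocks f : involutive f -> rank (blocks f) = #|dom f|.
Proof.
move=> fK; pose F x : {set vertex n} := [set inl x; f (inl x)].
have F_inj : {in dom f &, injective F}.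
  move=> x x' _; rewrite inE; case fx': (f (inl x')) => [//|y] _.
  by move/setP/(_ (inl x)); rewrite !inE fx' eqxx => /esym/orP[/eqP[]|].
rewrite /rank -(card_in_imset F_inj).
apply: eq_card => B; rewrite inE; apply/and3P/imsetP.
  case=> /mem_blocks[u ->] /existsP[x xB] /existsP[y yB].
  exists x.
    rewrite inE; move: xB yB; rewrite !inE => /orP[]/eqP ex /orP[]/eqP ey.
    - by rewrite -ex in ey.
    - by rewrite ex -ey.
    - by rewrite ex fK -ey.
    by rewrite -ex in ey.
  rewrite /F; move: xB; rewrite !inE => /orP[/eqP->|/eqP fu] //.
  by rewrite fu fK -fu setUC.
case=> x; rewrite inE; case fx: (f (inl x)) => [//|y] _ ->; split.
- by apply/mem_blocks; exists (inl x).
- by apply/existsP; exists x; rewrite !inE eqxx.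
by apply/existsP; exists y; rewrite !inE fx eqxx orbT.
Qed.

Section Product.
Variable f : {ffun vertex n -> vertex n}.
Hypothesis fK : involutive f.
Local Notation G := (pgraph (blocks f) (blocks f)).
Local Notation H := (adj (hooks f)).

Lemma set2_eq (T : finType) (p q r s : T) : p != q ->
  [set p; q] = [set r; s] -> (p = r /\ q = s) \/ (p = s /\ q = r).
Proof.
move=> pq e; have : p \in [set r; s] by rewrite -e !inE eqxx.
have : q \in [set r; s] by rewrite -e !inE eqxx orbT.
rewrite !inE => /orP[]/eqP eq /orP[]/eqP ep; [|by right|by left|];
  by rewrite ep eq eqxx in pq.
Qed.

Lemma exists_block_edge (h : vertex n -> pvertex n) p q : p != q ->
  reflect (exists v, p = h v /\ q = h (f v))
    [exists B in blocks f, [set p; q] == [set h v | v in B]].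
Proof.
move=> pq; apply: (iffP exists_inP) => [[B /mem_blocks[u ->] /eqP]|[v [-> ->]]].
  rewrite imsetU1 imset_set1 => /(set2_eq pq)[[-> ->]|[-> ->]]; first by exists u.
  by exists (f u); rewrite fK.
exists [set v; f v]; first by apply/mem_blocks; exists v.
by rewrite imsetU1 imset_set1.
Qed.

Lemma pgraphP p q : G p q -> exists v,
  (p = lower_to_mid v /\ q = lower_to_mid (f v)) \/
  (p = upper_to_mid v /\ q = upper_to_mid (f v)).
Proof.
case/andP=> pq /orP[]/(exists_block_edge _ pq)[v e]; exists v; by [left|right].
Qed.

Lemma connect_lower v : connect G (lower_to_mid v) (lower_to_mid (f v)).
Proof.
case: (eqVneq (lower_to_mid v) (lower_to_mid (f v))) => [->|e].
  exact: connect0.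
apply/connect1/andP; split=> //; apply/orP; left.
by apply/exists_block_edge => //; exists v.
Qed.

Lemma connect_upper v : connect G (upper_to_mid v) (upper_to_mid (f v)).
Proof.
case: (eqVneq (upper_to_mid v) (upper_to_mid (f v))) => [->|e].
  exact: connect0.
apply/connect1/andP; split=> //; apply/orP; right.
by apply/exists_block_edge => //; exists v.
Qed.

Lemma pgraph_sym : connect_sym G.
Proof.
apply: sym_connect_sym => p q; rewrite /pgraph eq_sym setUC.
by [].
Qed.

Lemma connect_mid z z' : connect H z z' -> connect G (inr z) (inr z').
Proof.
case/connectP=> p zp ->; elim: p z zp => //= y p IHp z /andP[/adjP[b zy] /IHp].
apply: connect_trans; move: zy; rewrite ffunE /=; case: b => /=.
  by have /= := connect_lower (inr z); case: (f _) => w //= c <-.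
by have /= := connect_upper (inl z); case: (f _) => w //= c <-.
Qed.

Lemma connect_block v : (forall x y, f (inl x) = inr y -> connect H x y) ->
  connect G (inl v) (inl (f v)).
Proof.
move=> fc; have sym := adj_connect_sym (hooks_invol (introT (involfP f) fK)).
have trav x y : f (inl x) = inr y -> connect G (inl (inl x)) (inl (inr y)).
  move=> fx; have fy : f (inr y) = inl x by rewrite -fx fK.
  have /= := connect_lower (inl x); rewrite fx => /connect_trans; apply.
  have /= := connect_upper (inl x); rewrite fx => /(connect_trans _); apply.
  by apply: connect_mid; rewrite sym fc.
case: v => [x|y].
  have /= := connect_lower (inl x); case fx: (f _) => [x'|y] //= _; exact: trav.
have /= := connect_upper (inr y); case fy: (f _) => [x|y'] //= _.
by rewrite pgraph_sym trav // -fy fK.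
Qed.

(** The vertices of the product graph attached to the middle component of z0:
    that component, and the outer vertices which a transversal links to it. *)
Definition through z0 (p : pvertex n) : bool :=
  match p with
  | inr z => connect H z0 z
  | inl (inl x) => if f (inl x) is inr y then connect H z0 y else false
  | inl (inr y) => if f (inr y) is inl x then connect H z0 x else false
  end.

Lemma through_connect z0 p q : connect G p q -> through z0 p -> through z0 q.
Proof.
case/connectP=> s ps ->; elim: s p ps => //= r s IHs p /andP[/pgraphP[v pr] /IHs IH] tp.
apply: IH; have := fK v; case fv: (f v) => [w|w] fw; case: pr tp => -[-> ->];
  rewrite fv; case: v fv fw => z fz fw /=; rewrite ?fz ?fw // => c.
all: apply: connect_trans c _; apply/connect1/adjP.
  by exists false; rewrite ffunE /= fz.
by exists true; rewrite ffunE /= fz.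
Qed.

(** An upper or lower block is a whole component of the product graph.  If u is
    on a transversal {x, y'}, the outer vertices reached from u are those attached
    to the middle component of y; this is an odd path that also contains x, and x
    is its only fixed point of that colour, so it carries no other transversal. *)
Lemma connect_in_block u v :
  (forall x y, f (inl x) = inr y -> connect H x y) ->
  connect G (inl u) (inl v) -> block_rel f u v.
Proof.
move=> fc; have hP := hooks_invol (introT (involfP f) fK).
have sym := adj_connect_sym hP.
have trav x y : f (inl x) = inr y -> connect G (inl (inl x)) (inl v) ->
    block_rel f (inl x) v.
  move=> fx /(through_connect (z0 := y)) tv.
  have fy : f (inr y) = inl x by rewrite -fx fK.
  have uniq_x z z' : f (inl z) = inr z' -> connect H y z' -> z = x.
    move=> fz yz'; symmetry.
    apply: (end_unique hP (c := false) (y := y)).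
    - by rewrite ffunE /= fx.
    - by rewrite ffunE /= fz.
    - by rewrite ffunE /= fy.
    - exact: fc.
    by apply: connect_trans (fc _ _ fx) (connect_trans yz' _); rewrite sym fc.
  have {}tv := tv _; rewrite /= fx connect0 in tv; have {tv} := tv isT.
  rewrite /block_rel; case: v => [z|z'] /=.
    by case fz: (f (inl z)) => [//|z'] /(uniq_x _ _ fz) ->; rewrite eqxx.
  case fz': (f (inr z')) => [z|//] yz.
  have fz : f (inl z) = inr z' by rewrite -fz' fK.
  have <- : z = x by apply: (uniq_x _ _ fz); apply: connect_trans yz (fc _ _ fz).
  by rewrite fz eqxx.
have hook u0 : (forall p q, G p q -> p \in [:: inl u0; inl (f u0)] ->
    q \in [:: inl u0; inl (f u0)]) -> connect G (inl u0) (inl v) ->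
    block_rel f u0 v.
  move=> Gu /connectP[p up ev]; pose L : seq (pvertex n) := [:: inl u0; inl (f u0)].
  have inL s : forall q, q \in L -> path G q s -> last q s \in L.
    elim: s => //= r s IHs q qL /andP[qr]; apply: IHs; exact: Gu qr qL.
  have := inL p _ (mem_head _ _) up; rewrite -ev !inE; exact.
case: u => [x|y] uv.
  case fx: (f (inl x)) => [x'|y]; last exact: trav fx uv.
  have fx' : f (inl x') = inl x by rewrite -fx fK.
  apply: hook uv => p q /pgraphP[w [] [-> ->]]; rewrite fx !inE;
    case: w => w //= /orP[]/eqP[->].
    by rewrite fx eqxx orbT.
  by rewrite fx' eqxx.
case fy: (f (inr y)) => [x|y'].
  have fx : f (inl x) = inr y by rewrite -fy fK.
  have : block_rel f (inl x) v.
    apply: trav fx _; apply: connect_trans uv; rewrite -fy.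
    by rewrite pgraph_sym; apply: connect_block.
  by rewrite /block_rel fx fy orbC.
have fy' : f (inr y') = inr y by rewrite -fy fK.
apply: hook uv => p q /pgraphP[w [] [-> ->]]; rewrite fy !inE;
  case: w => w //= /orP[]/eqP[->].
  by rewrite fy eqxx orbT.
by rewrite fy' eqxx.
Qed.

(** If the square is f, the transversal {x, y'} of the square runs through the
    middle row from y to x, so these are connected there.  Conversely, such
    connections make the outer vertices connected in the product graph exactly
    those in a common block ([connect_block] and [connect_in_block]). *)
Lemma mulPB_idem_matching :
  (mulPB (blocks f) (blocks f) == blocks f) = idem_matching f.
Proof.
have sym := adj_connect_sym (hooks_invol (introT (involfP f) fK)).
have Req : {in [set: vertex n] & &,
    equivalence_rel (fun u v => connect G (inl u) (inl v))}.
  move=> u v w _ _ _; split; first exact: connect0.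
  by move=> uv; apply: (same_connect pgraph_sym uv).
apply/eqP/idem_matchingP => [eq_blocks | [_ fc]].
  split=> // x y fx.
  have := equivalence_partition_inj Req (block_rel_equiv fK) eq_blocks.
  move/(_ (inl x) (inr y)); rewrite /block_rel fx eqxx orbT.
  have fy : f (inr y) = inl x by rewrite -fx fK.
  move/(through_connect (z0 := y)); rewrite /= fx fy connect0 sym.
  exact.
have eqR u v : connect G (inl u) (inl v) = block_rel f u v.
  apply/idP/idP; last first.
    by case/orP=> /eqP->; [exact: connect0 | exact: connect_block].
  exact: connect_in_block.
by apply: eq_imset => u; apply/setP=> v; rewrite !inE eqR.
Qed.

End Product.

Lemma card_idempotent_PB (P : pred nat) :
  #|[set a in PB n | (mulPB a a == a) && P (rank a)]| =
  #|[set f : {ffun vertex n -> vertex n} | idem_matching f & P #|dom f|]|.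
Proof.
pose I := [set f : {ffun vertex n -> vertex n} | idem_matching f & P #|dom f|].
rewrite -/I; have IK f : f \in I -> involutive f.
  by rewrite inE => /andP[/andP[/involfP]].
rewrite -(card_in_imset (f := blocks) (D := mem I)); last first.
  by move=> f f' /IK fK /IK f'K; apply: blocks_inj.
apply: eq_card => a; rewrite inE; apply/and3P/imsetP.
  case=> /PB_blocks[f fK ->]; rewrite mulPB_idem_matching // rank_blocks // => fI fP.
  by exists f; rewrite ?inE ?fI.
case=> f fI ->; have fK := IK f fI; move: fI; rewrite inE => /andP[fI fP].
by rewrite blocks_PB // mulPB_idem_matching // rank_blocks.
Qed.

Lemma card_idempotent_PB_sum (P : pred nat) (phi : nat -> rat) :
  (forall E : {set 'I_n},
     #|[set D : {set 'I_n} | D \subset E & P #|D|]|%:R = phi #|E|) ->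
  #|[set a in PB n | (mulPB a a == a) && P (rank a)]|%:R =
  n`!%:R * part_sum n phi n.
Proof.
move=> cardP; rewrite card_idempotent_PB card_idem_matching natr_sum.
under eq_bigr => t _ do rewrite cardP.
by have := @weight_sumE _ n phi [set: 'I_n]; rewrite cardsT card_ord; apply.
Qed.
End Blocks.

Theorem theorem23 (n : nat) :
  ((num_idem (PB n))%:R : rat) =
    n`!%:R *
    \sum_(mu in intparts n)
       (\prod_(1 <= j < (n./2).+1) (1 + 1 / (2 * j)%:R) ^+ mult mu (2 * j))
       / (\prod_(1 <= i < n.+1) (mult mu i)`!%:R)
       * 2 ^+ odd_parts mu
  /\
  (forall r : nat, (r <= n)%N ->
    ((num_idem (DPB n r))%:R : rat) =
      n`!%:R *
      \sum_(mu in intparts n | (odd_parts mu >= r)%N)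
         (\prod_(1 <= j < (n./2).+1) (1 + 1 / (2 * j)%:R) ^+ mult mu (2 * j))
         / (\prod_(1 <= i < n.+1) (mult mu i)`!%:R)
         * 'C(odd_parts mu, r)%:R).
Proof.
split=> [|r _].
  rewrite -(part_sumE n (fun d => 2 ^+ d)).
  rewrite -(card_idempotent_PB_sum (P := predT)) => [|E]; last first.
    rewrite -natrX -card_powerset; congr _%:R; apply: eq_card => D.
    by rewrite !inE andbT.
  by congr _%:R; apply: eq_card => a; rewrite !inE andbT.
have -> : num_idem (DPB n r) =
    #|[set a in PB n | (mulPB a a == a) && pred1 r (rank a)]|.
  by apply: eq_card => a; rewrite !inE -!andbA /= [(rank a == r) && _]andbC.
rewrite (card_idempotent_PB_sum (phi := fun d => 'C(d, r)%:R)) => [|E]; last first.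
  by rewrite -cards_draws.
rewrite part_sumE; congr (_ * _); rewrite [RHS]big_mkcondr.
apply: eq_bigr => mu _; case: leqP => // /bin_small ->; exact: mulr0.
Qed.
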